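(* Let $F$ be the distribution function of a phase-type distribution $\mathit{PH}(\alpha,A)$ with $\alpha=(\alpha_1,\dots,\alpha_n)$ and $\alpha_1+\cdots+\alpha_n>0$. Let $f$ be the density of the absolutely continuous part of $F$, and let $c>0$ be such that $$c_j:=\frac{d^{j}}{dx^{j}}\,e^{cx}f(x)\Big|_{x=0}>0\qquad\text{for all } j\in\mathbb{N}.$$ Then $F$ can be expressed as a mixture of Erlang distributions: there are non-negative numbers $p_j$, $j\ge 1$, such that, with $p_0=1-(\alpha_1+\cdots+\alpha_n)$, one has $\sum_{j=0}^{\infty}p_j=1$ and $$F(x)=p_0+\sum_{j=1}^{\infty}p_jF_{c,j}(x),\qquad x\ge 0.$$
   Context: $\mathbb{N}=\{0,1,2,\dots\}$. For $a>0$ and $j\in\{1,2,\dots\}$, $F_{a,j}$ is the Erlang distribution function with density $f_{a,j}(x)=\dfrac{a^{j}x^{j-1}e^{-ax}}{\Gamma(j)}$, $x>0$. Phase-type distributions: let $\alpha=(\alpha_1,\dots,\alpha_n)$ be a vector of non-negative numbers with $\alpha_1+\cdots+\alpha_n\le 1$, and let $A$ be an $n\times n$ real matrix with negative diagonal entries, non-negative off-diagonal entries and non-positive row sums. A non-negative random variable has the phase-type distribution $\mathit{PH}(\alpha,A)$ if its distribution function can be written as $F(x)=1-\alpha e^{xA}\mathbf{1}'$, $x\ge 0$, where $\mathbf 1'$ is the transpose of the $n$-dimensional vector $\mathbf 1=(1,\dots,1)$. Such $F$ has a point mass at $0$ of size $1-(\alpha_1+\cdots+\alpha_n)$. When $\alpha_1+\cdots+\alpha_n>0$,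 its (normalized) absolutely continuous part is the phase-type distribution $\mathit{PH}(\bar\alpha,A)$ with $\bar\alpha=(\alpha_1+\cdots+\alpha_n)^{-1}\alpha$, which has density $f(x)=-\bar\alpha e^{xA}A\mathbf 1'$; derivatives at $x=0$ are those of this expression at $0$. *)

(* Defs.v *)
From HB Require Import structures.
From mathcomp Require Export all_boot all_order all_algebra.
From mathcomp Require Export all_classical all_reals all_analysis.
Export Order.TTheory GRing.Theory Num.Theory.
Export numFieldNormedType.Exports.

Set Implicit Arguments.
Unset Strict Implicit.
Unset Printing Implicit Defensive.

Local Open Scope classical_set_scope.
Local Open Scope ring_scope.

Definition expmx (R : realType) (n : nat) (A : 'M[R]_n) : 'M[R]_n :=
  \matrix_(i, j) limn (fun N => \sum_(0 <= k < N) (A ^+ k) i j / k`!%:R).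

Definition Gamma (R : realType) (s : R) : R :=
  \int[lebesgue_measure]_(x in `]0, +oo[) (x `^ (s - 1) * expR (- x)).

(* Only meaningful for a > 0 and j >= 1. *)
Definition erlang_pdf (R : realType) (a : R) (j : nat) (x : R) : R :=
  if 0 < x then a ^+ j * x ^+ j.-1 * expR (- (a * x)) / Gamma j%:R else 0.

Definition erlang_cdf (R : realType) (a : R) (j : nat) (x : R) : R :=
  \int[lebesgue_measure]_(t in `]-oo, x]) erlang_pdf a j t.

Definition mass (R : realType) (n : nat) (alpha : 'rV[R]_n) : R :=
  \sum_(i < n) alpha 0 i.

Definition PH_parameters (R : realType) (n : nat)
    (alpha : 'rV[R]_n) (A : 'M[R]_n) : Prop :=
  [/\ forall i, 0 <= alpha 0 i,
      mass alpha <= 1,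
      forall i, A i i < 0,
      forall i j, i != j -> 0 <= A i j
    & forall i, \sum_(j < n) A i j <= 0].

(* A is allowed to be singular, in which case 1 - alpha e^{xA} 1' need not tend
   to 1 at +oo; requiring it to be the cdf of an actual random variable is
   therefore a genuine constraint on (alpha, A). *)
Definition has_PH_distribution d (T : measurableType d) (R : realType)
    (P : probability T R) (X : {RV P >-> R}) (n : nat)
    (alpha : 'rV[R]_n) (A : 'M[R]_n) : Prop :=
  [/\ PH_parameters alpha A,
      {ae P, forall t, 0 <= X t}
    & forall x : R, 0 <= x ->
        cdf X x = (1 - (alpha *m expmx (x *: A) *m (const_mx 1 : 'cV[R]_n)) 0 0)%:E].

(* The formula is used for every real x, so that its derivatives at 0 are
   two-sided. *)
Definition PH_ac_density (R : realType) (n : nat)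
    (alpha : 'rV[R]_n) (A : 'M[R]_n) (x : R) : R :=
  let alphabar := (mass alpha)^-1 *: alpha in
  - (alphabar *m expmx (x *: A) *m A *m (const_mx 1 : 'cV[R]_n)) 0 0.

(* Main.v *)
Require Import Defs.
From mathcomp Require Import measurable_realfun ring.

(** Write [1] for the all-ones column, [B := c I + A], and
    [q k := alpha B^k 1 / c^k].  The idea is uniformization, with a matrix [B]
    that may have entries of both signs: since [c I] commutes with [A],
    [e^{cx} (alpha e^{xA} 1) = alpha e^{xB} 1], so that the survival function is
<<
      1 - F(x) = e^{-y} \sum_k q_k y^k / k!,      y = c x,
>>
    a Poisson mean of the sequence [q].  Likewise
    [d^j/dx^j (e^{cx} f(x))] at [0] equals
    [alpha B^j (- A 1) / m = (c alpha B^j 1 - alpha B^{j+1} 1) / m], where [m] is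
    the mass of [alpha]; it is a positive multiple of [q_j - q_{j+1}].  The
    hypothesis on the derivatives thus says exactly that [q] decreases strictly, and the
    weights are [p_{j+1} := q_j - q_{j+1}].

    Their sum telescopes to [q_0 - lim q = m - lim q], so one needs [lim q = 0].
    This is a Tauberian statement made easy by monotonicity: the Poisson means
    of [q] tend to [lim q], and they tend to [0] because [F] is the distribution
    function of a random variable ([cvg_poisson_mean0]).

    Finally [F_{c,j}(x)] is the probability that a Poisson variable of
    parameter [c x] is at least [j] ([erlang_cdfE]), and an Abel summation of
    [\sum_j (q_j - q_{j+1}) F_{c,j+1}(x)] ([sum_poisson_tail_by_parts]) produces the Poisson
    sum of [q] above together with boundary terms tending to [m] and [0]. *)

Set Implicit Arguments.
Unset Strict Implicit.
Unset Printing Implicit Defensive.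
Local Open Scope classical_set_scope.
Local Open Scope ring_scope.

(** * Bilinear forms of a matrix exponential *)

Section MatrixExponential.
Variables (R : realType) (n : nat).
Implicit Types (A B : 'M[R]_n) (u : 'rV[R]_n) (w : 'cV[R]_n).

Definition mxform u A w : R := (u *m A *m w) 0 0.

Lemma mxformE u A w : mxform u A w = \sum_i \sum_j u 0 i * A i j * w j 0.
Proof.
rewrite /mxform mxE exchange_big; apply: eq_bigr => j _.
by rewrite mxE big_distrl.
Qed.

Lemma expr_scalemx (x : R) A k : (x *: A) ^+ k = x ^+ k *: A ^+ k.
Proof.
elim: k => [|k IH]; first by rewrite !expr0 scale1r.
by rewrite !exprS IH -!mulmxE -scalemxAl -scalemxAr scalerA.
Qed.

(** The sum of all the absolute values of the entries is a submultiplicative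
    bound, crude but enough to dominate every entry of the exponential series
    by a scalar exponential series. *)
Lemma norm_expr_mx_le A : exists2 M : R, 0 <= M &
  forall k i j, `|(A ^+ k) i j| <= M ^+ k.
Proof.
pose M := \sum_i \sum_j `|A i j|.
exists M; first by apply: sumr_ge0 => i _; apply: sumr_ge0.
have rowM (i : 'I_n) : \sum_j `|A i j| <= M.
  by rewrite [leRHS](bigD1 i)//= lerDl; apply: sumr_ge0 => l _; apply: sumr_ge0.
elim=> [|k IH] i j.
  by rewrite !expr0 mxE; case: eqP => _; rewrite ?normr1 ?normr0.
rewrite exprS -mulmxE mxE (le_trans (ler_norm_sum _ _ _))//.
apply: le_trans (_ : \sum_l `|A i l| * M ^+ k <= _).
  by apply: ler_sum => l _; rewrite normrM ler_wpM2l.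
rewrite -big_distrl exprS ler_wpM2r ?exprn_ge0//.
by apply: sumr_ge0 => l _; apply: sumr_ge0.
Qed.

Lemma is_cvg_expmx_entry A i j :
  cvgn (fun N => \sum_(0 <= k < N) (A ^+ k) i j / k`!%:R).
Proof.
have [M M0 AM] := norm_expr_mx_le A.
apply: normed_cvg; apply: (@series_le_cvg _ _ (exp_coeff M)).
- by move=> k; rewrite /= normr_ge0.
- by move=> k; exact: exp_coeff_ge0.
- move=> k; rewrite /= normrM [X in _ * X]ger0_norm ?invr_ge0//.
  by rewrite /exp_coeff/= ler_wpM2r ?invr_ge0.
- exact: is_cvg_series_exp_coeff.
Qed.

Lemma cvg_mxform_expmx u A w :
  (fun N => \sum_(0 <= k < N) mxform u (A ^+ k) w / k`!%:R) @ \oo -->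
  mxform u (expmx A) w.
Proof.
have -> : (fun N => \sum_(0 <= k < N) mxform u (A ^+ k) w / k`!%:R) =
    (fun N => \sum_i \sum_j (u 0 i * w j 0 *
       \sum_(0 <= k < N) (A ^+ k) i j / k`!%:R)).
  apply/funext => N.
  under [RHS]eq_bigr => i _ do
    (under eq_bigr do rewrite big_distrr/=; rewrite exchange_big/=).
  rewrite [RHS]exchange_big/=; apply: eq_bigr => k _.
  rewrite mxformE big_distrl; apply: eq_bigr => i _.
  rewrite big_distrl; apply: eq_bigr => j _ /=.
  by rewrite !mulrA; congr (_ / _); rewrite mulrAC.
rewrite mxformE.
apply: cvg_big => [|i _]; first exact: add_continuous.
apply: cvg_big => [|j _]; first exact: add_continuous.
by rewrite mulrAC mxE; apply: cvgMl_tmp; exact: is_cvg_expmx_entry.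
Qed.

Lemma cvg_mxform_pseries u A w (x : R) :
  pseries (fun k => mxform u (A ^+ k) w / k`!%:R) x @ \oo -->
  mxform u (expmx (x *: A)) w.
Proof.
rewrite (_ : pseries _ _ =
    (fun N => \sum_(0 <= k < N) mxform u ((x *: A) ^+ k) w / k`!%:R)).
  exact: cvg_mxform_expmx.
apply/funext => N; apply: eq_bigr => k _.
by rewrite expr_scalemx /mxform -scalemxAr -scalemxAl mxE -[RHS]mulrA [RHS]mulrC.
Qed.

Lemma mxform_expmxE u A w (x : R) : mxform u (expmx (x *: A)) w =
  limn (pseries (fun k => mxform u (A ^+ k) w / k`!%:R) x).
Proof. by apply/esym/cvg_lim => //; exact: cvg_mxform_pseries. Qed.

Lemma is_cvg_mxform_pseries u A w (x : R) :
  cvgn (pseries (fun k => mxform u (A ^+ k) w / k`!%:R) x).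
Proof. exact: cvgP (@cvg_mxform_pseries u A w x). Qed.

(** Termwise differentiation amounts to multiplying the right vector by [A];
    the family of these power series is therefore closed under differentiation,
    which provides all the convergence hypotheses of the next lemma. *)
Lemma pseries_diffs_mxform u A w :
  pseries_diffs (fun k => mxform u (A ^+ k) w / k`!%:R) =
  (fun k => mxform u (A ^+ k) (A *m w) / k`!%:R).
Proof.
apply/funext => k; rewrite /pseries_diffs factS natrM invfM.
rewrite mulrCA mulVKf ?pnatr_eq0//.
by rewrite /mxform exprSr -mulmxE !mulmxA.
Qed.

Lemma is_derive_mxform_expmx u A w (x : R) :
  is_derive x 1 (fun t => mxform u (expmx (t *: A)) w)
    (mxform u (expmx (x *: A)) (A *m w)).
Proof.
under eq_fun do rewrite mxform_expmxE.
rewrite mxform_expmxE -pseries_diffs_mxform.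
apply: (@pseries_snd_diffs _ _ (`|x| + 1)).
- exact: is_cvg_mxform_pseries.
- by rewrite pseries_diffs_mxform; exact: is_cvg_mxform_pseries.
- by rewrite !pseries_diffs_mxform; exact: is_cvg_mxform_pseries.
- by rewrite [ltRHS]ger0_norm ?addr_ge0// ltrDl.
Qed.

Lemma expmx0 : expmx (0 : 'M[R]_n) = 1%:M.
Proof.
apply/matrixP => i j; rewrite mxE; apply/cvg_lim => //.
apply: (@cvg_near_cst _ _ _ (fun N => \sum_(0 <= k < N) ((0 : 'M[R]_n) ^+ k) i j / k`!%:R)).
exists 1%N => // -[//|N] _ /=; rewrite big_nat_recl// expr0 divr1 big1 ?addr0// => k _.
by rewrite exprS mul0r mxE mul0r.
Qed.

Lemma mxform_comm u A w (x : R) :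
  mxform u (expmx (x *: A)) (A *m w) = mxform (u *m A) (expmx (x *: A)) w.
Proof.
rewrite !mxform_expmxE; congr (limn (pseries _ x)); apply/funext => k.
congr (_ / _); rewrite /mxform !mulmxA; congr ((_ *m _) 0 0).
by rewrite -!mulmxA; congr (_ *m _); rewrite mulmxE -exprS -exprSr.
Qed.

(** Inserting the resolution of the identity by the canonical basis reduces the
    derivative of a product of matrices to that of products of scalars. *)
Lemma mxform_mulmx u A B w :
  mxform u (A *m B) w =
  \sum_l mxform u A (delta_mx l 0) * mxform (delta_mx 0 l) B w.
Proof.
rewrite /mxform -mulmxA -mulmxA mulmxA mxE; apply: eq_bigr => l _.
by rewrite -colE -[delta_mx 0 l *m B *m w]mulmxA -rowE [col _ _ _ _]mxE [row _ _ _ _]mxE.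
Qed.

(** The derivatives of the two factors are taken on the inner sides, next to
    each other, so that they combine into [B - A] whether or not [A] and [B]
    commute. *)
Lemma is_derive_mxform_expmxM u A B w (x s : R) :
  is_derive s 1
    (fun t => mxform u (expmx (t *: B) *m expmx ((x - t) *: A)) w)
    (mxform u (expmx (s *: B) *m ((B - A) *m expmx ((x - s) *: A))) w).
Proof.
under eq_fun do rewrite mxform_mulmx.
pose f l (t : R) := mxform u (expmx (t *: B)) (delta_mx l 0).
pose g l (t : R) := mxform (delta_mx 0 l) (expmx (t *: A)) w.
have dg l : is_derive s 1 (fun t => g l (x - t)) (- mxform (delta_mx 0 l) (expmx ((x - s) *: A)) (A *m w)).
  have h : is_derive s (1 : R) (fun t => x - t) (0 - 1).
    exact: (is_deriveB (is_derive_cst x s 1) (is_derive_id s 1)).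
  have dgl := is_derive_mxform_expmx (delta_mx 0 l) A w (x - s).
  have := @is_derive1_comp _ (g l) (fun t => x - t) s _ _ dgl h.
  by move/is_derive_eq; apply; rewrite sub0r mulrN1.
have := is_derive_sum (fun l => is_deriveM (is_derive_mxform_expmx u B (delta_mx l 0) s) (dg l)).
rewrite (_ : \sum_(i < n) _ = (fun t => \sum_l f l t * g l (x - t))); last first.
  by apply/funext => t; rewrite fct_sumE.
move/is_derive_eq; apply.
transitivity (\sum_l (mxform u (expmx (s *: B) *m B) (delta_mx l 0) * g l (x - s)
    - f l s * mxform (delta_mx 0 l) (A *m expmx ((x - s) *: A)) w)).
  apply: eq_bigr => l _; rewrite /GRing.scale/= mulrN addrC [X in X - _]mulrC.
  congr (_ * _ - _ * _); last by rewrite mxform_comm /mxform !mulmxA.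
  by rewrite /mxform !mulmxA.
rewrite sumrB -!mxform_mulmx /mxform mulmxBl mulmxBr mulmxBr mulmxBl.
rewrite !mulmxA [RHS]mxE; congr (_ + _).
by rewrite [RHS]mxE.
Qed.

(** The function [s |-> e^{-cs} u e^{s(cI + A)} e^{(x-s)A} w] has derivative
    zero; comparing its values at [0] and [x] gives the identity. *)
Lemma mxform_expmx_shift (c : R) u A w x :
  mxform u (expmx (x *: (c%:M + A))) w = expR (c * x) * mxform u (expmx (x *: A)) w.
Proof.
set B := c%:M + A.
pose h (s : R) := expR (- c * s) *
  mxform u (expmx (s *: B) *m expmx ((x - s) *: A)) w.
suff hx : h x = h 0.
  move: hx; rewrite /h subrr subr0 !scale0r expmx0 mulmx1 mul1mx mulr0 expR0 mul1r.
  by move=> <-; rewrite mulrA -expRD mulNr subrr expR0 mul1r.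
apply: is_derive_0_is_cst => s.
have dc : is_derive s (1 : R) (fun t => - c * t) (- c).
  have := is_deriveZ (- c) (is_derive_id s 1).
  by move/is_derive_eq; apply; rewrite /GRing.scale/= mulr1.
have de := is_derive1_comp (is_derive_expR (- c * s)) dc.
have := is_deriveM de (is_derive_mxform_expmxM u A B w x s).
move/is_derive_eq; apply.
rewrite /B addrK mul_scalar_mx /mxform /= -scalemxAr -scalemxAr -scalemxAl mxE.
rewrite /GRing.scale/=.
by ring.
Qed.

Lemma is_derive_expR_mxform (c : R) u A w (x : R) :
  is_derive x 1 (fun t => expR (c * t) * mxform u (expmx (t *: A)) w)
    (expR (c * x) * mxform u (expmx (x *: A)) ((c%:M + A) *m w)).
Proof.
under eq_fun do rewrite -mxform_expmx_shift.
by rewrite -mxform_expmx_shift; exact: is_derive_mxform_expmx.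
Qed.

Lemma derive1n_expR_mxform (c : R) u A w j (x : R) :
  derive1n j (fun t => expR (c * t) * mxform u (expmx (t *: A)) w) x =
  expR (c * x) * mxform u (expmx (x *: A)) ((c%:M + A) ^+ j *m w).
Proof.
elim: j x => [|j IH] x; first by rewrite derive1n0 expr0 mul1mx.
rewrite derive1nS (funext IH) derive1E.
by rewrite (@derive_val _ _ _ _ _ _ _ (is_derive_expR_mxform _ _ _ _ _)) exprS -mulmxE mulmxA.
Qed.

End MatrixExponential.

(** * Erlang distributions and Poisson tails *)

Section ErlangPoisson.
Variable R : realType.
Implicit Types (c x y : R) (q : nat -> R).

(** Keeping only the term of degree [k + 1] in the exponential series gives
    [y^k e^{-y} <= (k + 1)! / y]. *)
Lemma cvgry_mulexpRN_exp (k : nat) : (y ^+ k * expR (- y)) @[y --> +oo] --> (0 : R).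
Proof.
have cv : k.+1`!%:R / y @[y --> +oo] --> (0 : R).
  rewrite -(mulr0 (k.+1`!%:R : R)); apply: cvgMl_tmp.
  by apply/gtr0_cvgV0; [near=> y; near: y; exact: nbhs_pinfty_gt|exact: cvg_id].
apply: (squeeze_cvgr _ (cvg_cst 0) cv).
near=> y.
have y0 : 0 < y by near: y; exact: nbhs_pinfty_gt.
rewrite mulr_ge0 ?expR_ge0 ?exprn_ge0 ?(ltW y0)//=.
rewrite expRN ler_pdivrMr ?expR_gt0// mulrAC ler_pdivlMr// -exprSr.
rewrite -ler_pdivrMl ?ltr0n ?fact_gt0// mulrC.
by apply: le_trans (expR_ge1Dxn k (ltW y0)); rewrite lerDr.
Unshelve. all: by end_near. Qed.

Lemma cvgry_mulexpRN_sum (a : nat -> R) K :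
  expR (- y) * (\sum_(0 <= k < K) a k * exp_coeff y k) @[y --> +oo] --> (0 : R).
Proof.
have -> : (fun y => expR (- y) * (\sum_(0 <= k < K) a k * exp_coeff y k)) =
  (fun y => \sum_(0 <= k < K) (a k / k`!%:R) * (y ^+ k * expR (- y))).
  apply/funext => y; rewrite big_distrr; apply: eq_bigr => k _ /=.
  by rewrite /exp_coeff /=; ring.
have sum0 : \sum_(0 <= k < K) (0 : R) = 0 by rewrite big1.
rewrite -[X in _ --> X]sum0.
apply: cvg_big => [|k _]; first exact: add_continuous.
by rewrite -(mulr0 (a k / k`!%:R)); apply: cvgMl_tmp; exact: cvgry_mulexpRN_exp.
Qed.

(** The probability that a Poisson variable of parameter [y] is at least [j],
    for [y >= 0]. *)
Definition poisson_tail j y : R := 1 - expR (- y) * series (exp_coeff y) j.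

Lemma poisson_tailS j y :
  poisson_tail j.+1 y = poisson_tail j y - expR (- y) * (y ^+ j / j`!%:R).
Proof. by rewrite /poisson_tail seriesSr; rewrite /exp_coeff/=; ring. Qed.

Lemma poisson_tail0 y : poisson_tail 0 y = 1.
Proof. by rewrite /poisson_tail /series/= big_geq// mulr0 subr0. Qed.

Lemma poisson_tailS_at0 j : poisson_tail j.+1 0 = 0.
Proof.
by rewrite /poisson_tail series_exp_coeff0 oppr0 expR0 mulr1 subrr.
Qed.

(** The derivative of [e^{-y} y^k / k!] is the difference of the terms of index
    [k - 1] and [k], so that the derivative of the sum telescopes, leaving the density of the Erlang distribution of rate 1. *)
Lemma is_derive_poisson_tail j y :
  is_derive y 1 (poisson_tail j.+1) (y ^+ j * expR (- y) / j`!%:R).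
Proof.
have de : is_derive y (1 : R) (fun t => expR (- t)) (- expR (- y)).
  have := is_derive1_comp (is_derive_expR (- y)) (is_deriveNid y 1).
  by move/is_derive_eq; apply; rewrite mulrN1.
elim: j => [|j IH].
  have -> : poisson_tail 1 = cst 1 - (fun t => expR (- t)).
    by apply/funext => t; rewrite poisson_tailS poisson_tail0 expr0 divr1 mulr1.
  have := is_deriveB (is_derive_cst (1 : R) y 1) de.
  by move/is_derive_eq; apply; rewrite fact0 expr0 divr1 mul1r sub0r opprK.
have -> : poisson_tail j.+2 = poisson_tail j.+1 -
    (fun t => expR (- t)) * (j.+1`!%:R^-1 \*: (fun t => t ^+ j.+1)).
  apply/funext => t; rewrite poisson_tailS; congr (_ - _ * _).
  by rewrite mulrC.
have dX : is_derive y (1 : R) (fun t => t ^+ j.+1) (j.+1%:R * y ^+ j *: 1).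
  have := is_deriveX j.+1 (is_derive_id y 1).
  by rewrite exprfctE.
have := is_deriveB IH (is_deriveM de (is_deriveZ j.+1`!%:R^-1 dX)).
move/is_derive_eq; apply; rewrite /GRing.scale/= factS natrM.
rewrite /= /GRing.scale/= exprS; field.
by rewrite !pnatr_eq0 -lt0n fact_gt0 nat1r pnatr_eq0.
Qed.

Lemma cvgry_poisson_tail j : poisson_tail j y @[y --> +oo] --> (1 : R).
Proof.
rewrite -[X in _ --> X]subr0; apply: cvgB; first exact: cvg_cst.
have := cvgry_mulexpRN_sum (fun=> 1) j; apply: cvg_trans.
rewrite (_ : (fun y => _) =
  (fun y => expR (- y) * \sum_(0 <= k < j) 1 * exp_coeff y k))//.
apply/funext => y; congr (_ * _); apply: eq_bigr => k _.
by rewrite mul1r.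
Qed.

Lemma continuous_expN_poly j : continuous (fun y : R => y ^+ j * expR (- y)).
Proof.
move=> y; apply: cvgM; first exact: exprn_continuous.
apply: (continuous_comp (@oppr_continuous _ _ _)); exact: continuous_expR.
Qed.

(** [j! * poisson_tail j.+1] is a primitive of the integrand that vanishes at
    [0] and tends to [j!] at infinity. *)
Lemma Gamma_natS j : Gamma (j.+1%:R : R) = j`!%:R.
Proof.
have dF (y : R) : is_derive y 1 (j`!%:R \*: poisson_tail j.+1) (y ^+ j * expR (- y)).
  have := is_deriveZ j`!%:R (is_derive_poisson_tail j y).
  move/is_derive_eq; apply.
  by rewrite /GRing.scale/= mulrC divfK// pnatr_eq0 -lt0n fact_gt0.
rewrite /Gamma.
transitivity (\int[lebesgue_measure]_(y in `]0%R, +oo[) (y ^+ j * expR (- (y : R)))).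
  apply: eq_Rintegral => y; rewrite inE/= in_itv/= andbT => y0.
  by rewrite -natr1 addrK powR_mulrn// ltW.
rewrite /Rintegral integral_itv_obnd_cbnd; last first.
  apply/measurable_EFinP/measurable_funTS; apply: continuous_measurable_fun.
  exact: continuous_expN_poly.
rewrite -/(Rintegral _ _ _) (@Rintegral_ge0_continuous_FTC2y _ _ (j`!%:R \*: poisson_tail j.+1) 0 j`!%:R).
- by rewrite /= poisson_tailS_at0 scaler0 subr0.
- by move=> y y0; rewrite mulr_ge0 ?exprn_ge0 ?expR_ge0.
- exact/continuous_subspaceT/continuous_expN_poly.
- rewrite -[X in _ --> X]mulr1; apply: cvgMl_tmp; exact: cvgry_poisson_tail.
- by move=> y _; have [] := dF y.
- apply: cvg_at_right_filter; apply/differentiable_continuous/derivable1_diffP.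
  by have [] := dF 0.
- by move=> y _; rewrite derive1E (@derive_val _ _ _ _ _ _ _ (dF y)).
Qed.

(** The waiting time for the [j+1]-st point of a Poisson process of rate [c] is
    at most [x] exactly when at least [j+1] points fall before [x]; analytically,
    both sides vanish at [0] and have the same derivative. *)
Lemma erlang_cdfE c j x : 0 < c -> 0 <= x ->
  erlang_cdf c j.+1 x = poisson_tail j.+1 (c * x).
Proof.
move=> c0 x0.
pose f (t : R) := c / j`!%:R * ((c * t) ^+ j * expR (- (c * t))).
have cf : continuous f.
  move=> t; apply: cvgMl_tmp.
  apply: (@continuous_comp _ _ _ (fun t => c * t) (fun y => y ^+ j * expR (- y))).
    exact: mulrl_continuous.
  exact: continuous_expN_poly.
have dc (t : R) : is_derive t (1 : R) (fun t => c * t) c.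
  have := is_deriveZ c (is_derive_id t 1).
  by move/is_derive_eq; apply; rewrite /GRing.scale/= mulr1.
have dF (t : R) : is_derive t 1 (fun t => poisson_tail j.+1 (c * t)) (f t).
  have := is_derive1_comp (is_derive_poisson_tail j (c * t)) (dc t).
  by move/is_derive_eq; apply; rewrite /f; ring.
have -> : erlang_cdf c j.+1 x = \int[lebesgue_measure]_(t in `]0%R, x]) f t.
  rewrite /erlang_cdf Rintegral_mkcond [RHS]Rintegral_mkcond; congr Rintegral.
  apply/funext => t; rewrite !patchE !mem_setE !in_itv/= /erlang_pdf Gamma_natS.
  case: (t <= x); rewrite ?andbF ?andbT//; case: ifP => // _.
  by rewrite /f exprMn exprS; ring.
rewrite /Rintegral integral_itv_obnd_cbnd; last first.
  by apply/measurable_EFinP/measurable_funTS; exact: continuous_measurable_fun.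
move: x0; rewrite le_eqVlt => /predU1P[<-|x0].
  by rewrite set_itv1 integral_set1 mulr0 poisson_tailS_at0.
rewrite (@continuous_FTC2 _ f (fun t => poisson_tail j.+1 (c * t)))//.
- by rewrite -EFinB/= mulr0 poisson_tailS_at0 subr0.
- exact/continuous_subspaceT.
- have cF : continuous (fun t => poisson_tail j.+1 (c * t)).
    by move=> t; apply/differentiable_continuous/derivable1_diffP; have [] := dF t.
  split=> [t _||]; first by have [] := dF t.
  + exact: cvg_at_right_filter (cF _).
  + exact: cvg_at_left_filter (cF _).
- by move=> t _; rewrite derive1E (@derive_val _ _ _ _ _ _ _ (dF t)).
Qed.

(** Abel summation: consecutive Poisson tails differ by one Poisson
    probability. *)
Lemma sum_poisson_tail_by_parts q y M :
  \sum_(0 <= j < M) (q j - q j.+1) * poisson_tail j.+1 y =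
  q 0%N - q M * poisson_tail M y
  - expR (- y) * \sum_(0 <= k < M) q k * exp_coeff y k.
Proof.
elim: M => [|M IH].
  by rewrite !big_geq// /poisson_tail /series/= big_geq//; ring.
rewrite !big_nat_recr//= IH /poisson_tail !seriesS.
by ring.
Qed.

Lemma cvg_series_expR y : series (exp_coeff y) @ \oo --> expR y.
Proof. exact: is_cvg_series_exp_coeff. Qed.

(** Here [G y] is the Poisson mean of [q] with parameter [y].  As [q]
    decreases, replacing [q k] by [q K] for all [k >= K] only increases the mean,
    and the finitely many other terms vanish as [y] grows: hence
    [0 = lim G <= q K].  So [q] has a limit [l >= 0]; it bounds [q], hence [G],
    from below, whence [l <= lim G = 0]. *)
Lemma cvg_poisson_mean0 q (G : R -> R) :
  nonincreasing_seq q ->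
  (forall y, 0 <= y -> (fun N => \sum_(0 <= k < N) q k * exp_coeff y k) @ \oo -->
     expR y * G y) ->
  G y @[y --> +oo] --> 0 ->
  q @ \oo --> 0.
Proof.
move=> qd qG G0.
have q_ge0 K : 0 <= q K.
  have cv : q K + expR (- y) * (\sum_(0 <= k < K) (q k - q K) * exp_coeff y k)
      @[y --> +oo] --> q K.
    rewrite -[X in _ --> X]addr0; apply: cvgD; first exact: cvg_cst.
    exact: cvgry_mulexpRN_sum.
  apply: (ler_cvg_to G0 cv); near=> y.
  have y0 : 0 <= y by near: y; exact: nbhs_pinfty_ge.
  rewrite -(ler_pM2l (expR_gt0 y)) mulrDr [leRHS]addrC mulrA -expRD subrr expR0 mul1r.
  have cv2 : (fun N => (\sum_(0 <= k < K) (q k - q K) * exp_coeff y k)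
      + series (exp_coeff y) N * q K) @ \oo -->
      (\sum_(0 <= k < K) (q k - q K) * exp_coeff y k) + expR y * q K.
    by apply: cvgD; [exact: cvg_cst|apply: cvgMr_tmp; exact: cvg_series_expR].
  apply: (ler_cvg_to (qG y y0) cv2); near=> N.
  have KN : (K <= N)%N by near: N; exact: nbhs_infty_ge.
  rewrite [leLHS](big_cat_nat _ KN)//= /series/= [X in _ + X * _](big_cat_nat _ KN)//=.
  rewrite mulrDl addrA !big_distrl -big_split/=.
  under [X in _ <= X + _]eq_bigr do rewrite mulrBl (mulrC (exp_coeff y _)) subrK.
  rewrite lerD2l big_nat_cond [leRHS]big_nat_cond ler_sum// => k /andP[/andP[Kk _] _].
  by rewrite mulrC ler_wpM2l ?exp_coeff_ge0// qd.
have [l ql] : exists l : R, q @ \oo --> l.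
  by exists (limn q); apply: nonincreasing_is_cvgn => //; exists 0 => _ [k _ <-].
have lq k : l <= q k.
  by rewrite -(cvg_lim _ ql)//; apply: nonincreasing_cvgn_ge => //; apply: cvgP ql.
have l0 : 0 <= l.
  by rewrite -(cvg_lim _ ql)//; apply: limr_ge; [exact: cvgP ql|exact: nearW].
suff -> : 0 = l by [].
apply/le_anti; rewrite l0/=.
rewrite -(cvg_lim _ G0)//; apply: limr_ge; [exact: cvgP G0|near=> y].
have y0 : 0 <= y by near: y; exact: nbhs_pinfty_ge.
rewrite -(ler_pM2l (expR_gt0 y)).
have cl : series (exp_coeff y) N * l @[N --> \oo] --> expR y * l.
  by apply: cvgMr_tmp; exact: cvg_series_expR.
apply: (ler_cvg_to cl (qG y y0)); apply: nearW => N.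
rewrite /series/= big_distrl ler_sum// => k _.
by rewrite [leRHS]mulrC ler_wpM2l ?exp_coeff_ge0.
Unshelve. all: by end_near. Qed.

End ErlangPoisson.

(** * Erlang mixtures of phase-type distributions *)

Theorem proposition5p3 (R : realType) (d : measure_display)
    (T : measurableType d) (P : probability T R) (X : {RV P >-> R})
    (n : nat) (alpha : 'rV[R]_n) (A : 'M[R]_n) (F : R -> R) (c : R)
    (hF : forall x : R, cdf X x = (F x)%:E)
    (hX : has_PH_distribution X alpha A)
    (halpha : 0 < mass alpha)
    (hc : 0 < c)
    (hcj : forall j : nat,
       0 < derive1n j (fun x : R => expR (c * x) * PH_ac_density alpha A x) 0) :
  exists p : nat -> R,
    [/\ p 0%N = 1 - mass alpha,
        forall j : nat, (1 <= j)%N -> 0 <= p j,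
        (fun N : nat => \sum_(0 <= j < N) p j) @ \oo --> (1 : R)
      & forall x : R, 0 <= x ->
          (fun N : nat =>
             p 0%N + \sum_(1 <= j < N) p j * erlang_cdf c j x) @ \oo --> F x].
Proof.
have [_ _ cdfE] := hX.
pose one : 'cV[R]_n := const_mx 1.
pose B := c%:M + A.
pose b k := mxform alpha (B ^+ k) one.
pose q k := b k / c ^+ k.
pose G y := mxform alpha (expmx ((y / c) *: A)) one.
have c_neq0 : c != 0 by rewrite gt_eqF.
have FE x : 0 <= x -> F x = 1 - G (c * x).
  by move=> x0; apply/EFin_inj; rewrite -hF cdfE// /G mulrAC divff// mul1r.
have q0 : q 0%N = mass alpha.
  rewrite /q /b !expr0 divr1 /mxform mulmx1 mxE.
  by apply: eq_bigr => i _; rewrite mxE mulr1.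
(* [- A 1 = c 1 - B 1], so the derivatives involve only two consecutive [b]. *)
have derE j : derive1n j (fun x => expR (c * x) * PH_ac_density alpha A x) 0 =
    (mass alpha)^-1 * (c * b j - b j.+1).
  have -> : PH_ac_density alpha A = (fun x =>
      mxform ((mass alpha)^-1 *: alpha) (expmx (x *: A)) (- (A *m one))).
    by apply/funext => x; rewrite /mxform mulmxN mxE !mulmxA.
  rewrite derive1n_expR_mxform mulr0 expR0 mul1r scale0r expmx0.
  have -> : - (A *m one) = c *: one - B *m one.
    by rewrite /B mulmxDl mul_scalar_mx opprD addrA subrr sub0r.
  rewrite /mxform mulmx1 -scalemxAl mxE; congr (_ * _).
  rewrite mulmxA mulmxBr -scalemxAr !mulmxA /b exprSr -mulmxE /mxform !mulmxA.
  by rewrite [LHS]mxE [X in X + _ = _]mxE [X in _ + X = _]mxE.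
have qE j : q j - q j.+1 = (c * b j - b j.+1) / c ^+ j.+1.
  by rewrite /q exprS; field; rewrite c_neq0 expf_neq0.
have q_ge k : 0 <= q k - q k.+1.
  rewrite qE divr_ge0 ?exprn_ge0 ?ltW//.
  by have := hcj k; rewrite derE pmulr_rgt0 ?invr_gt0.
(* The Poisson mean of [q] is the survival function in the time scale
   [y = c x]. *)
have qG y : (fun N => \sum_(0 <= k < N) q k * exp_coeff y k) @ \oo -->
    expR y * G y.
  have := @cvg_mxform_pseries _ _ alpha B one (y / c).
  rewrite mxform_expmx_shift mulrCA divff// mulr1; apply: cvg_trans.
  rewrite (_ : (fun _ => _) = pseries (fun k => b k / k`!%:R) (y / c))//.
  apply/funext => N; apply: eq_bigr => k _; rewrite /exp_coeff/= /q expr_div_n.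
  by rewrite mulrAC -!mulrA; congr (_ * _); rewrite mulrCA mulrA.
(* The one place where [F] must be the distribution function of a genuine
   random variable: it has no mass at infinity. *)
have G0 : G y @[y --> +oo] --> 0.
  have F1 : F x @[x --> +oo] --> (1 : R).
    have := cvg_cdfy1 X; rewrite (funext hF).
    by move/fine_cvgP => [].
  have F1c : F (y / c) @[y --> +oo] --> (1 : R).
    apply: cvg_comp F1; apply/cvgryPge => r; near=> y.
    by rewrite ler_pdivlMr//; near: y; exact: nbhs_pinfty_ge.
  have : 1 - F (y / c) @[y --> +oo] --> 1 - (1 : R).
    by apply: cvgB; [exact: cvg_cst|].
  rewrite subrr; apply: cvg_trans; apply: near_eq_cvg; near=> y.
  rewrite FE; first by rewrite opprB addrCA subrr addr0 mulrCA divff// mulr1.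
  by rewrite divr_ge0 ?ltW//; near: y; exact: nbhs_pinfty_gt.
have q_cvg0 : q @ \oo --> 0.
  apply: (cvg_poisson_mean0 _ (fun y _ => qG y) G0).
  by apply/nonincreasing_seqP => k; rewrite -subr_ge0.
exists (fun j => if j is k.+1 then q k - q k.+1 else 1 - mass alpha); split => //.
- by case=> // k _; exact: q_ge.
- rewrite -cvg_shiftS.
  rewrite (_ : (fun _ => _) = fun N => 1 - q N).
    have : 1 - q N @[N --> \oo] --> 1 - (0 : R).
      by apply: cvgB => //; exact: cvg_cst.
    by rewrite subr0.
  apply/funext => N; rewrite big_nat_recl//= -q0.
  rewrite (eq_bigr (fun i => - (q i.+1 - q i))); last by move=> ? _; rewrite opprB.
  by rewrite sumrN telescope_sumr//; ring.
- move=> x x0; rewrite -cvg_shiftS (FE _ x0).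
  rewrite (_ : (fun _ => _) = fun N => 1 - q N * poisson_tail N (c * x) -
      expR (- (c * x)) * \sum_(0 <= k < N) q k * exp_coeff (c * x) k).
    (* The limit is written in the shape that the limit theorems produce. *)
    have lim1 : 1 - G (c * x) = 1 - 0 * (1 - expR (- (c * x)) * expR (c * x))
        - expR (- (c * x)) * (expR (c * x) * G (c * x)).
      by rewrite mulrA -expRD addNr expR0; ring.
    rewrite lim1; apply: cvgB; last by apply: cvgMl_tmp; exact: qG.
    apply: cvgB; first exact: cvg_cst.
    apply: cvgM => //; apply: cvgB; first exact: cvg_cst.
    by apply: cvgMl_tmp; exact: cvg_series_expR.
  apply/funext => N; rewrite big_add1/=.
  under eq_bigr do rewrite erlang_cdfE//.
  by rewrite sum_poisson_tail_by_parts q0; ring.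
Unshelve. all: by end_near. Qed.
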